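(* Let $M$ be a complete connected Riemannian manifold and $Z$ a smooth vector field on $M$. Let $X=X(x)$ be a non-explosive diffusion with generator $\Delta+Z$ on $M$, starting at $X_0(x)=x$. Let $T>0$ and let $h$ be an adapted real-valued process with paths in $L^{1,2}([0,T];\mathbb{R})$ such that $h_0=0$ and $h_T=1$. Suppose $f$ is a bounded smooth function on $M$ and that $V$ is a bounded smooth vector field on $M$ with $\operatorname{div}V$ bounded. Put $\alpha=(fV)^\flat$ and assume that the process $$(\operatorname{div}\alpha_{T-t})(X_t(x))\,h_t-\frac12\,\alpha_{T-t}\left(/\!/_t\,\Theta_t\int_0^t\left(\dot h_s-(\operatorname{div}Z)(X_s(x))h_s\right)\Theta_s^{-1}\,dB_s\right),\qquad 0\le t\le T,$$ is a true martingale. Then $$P_T(V(f))(x)=-\mathbb{E}\bigl[f(X_T(x))\,(\operatorname{div}V)(X_T(x))\bigr]+\frac12\,\mathbb{E}\left[f(X_T(x))\Bigl\langle V(X_T(x)),\,/\!/_T\,\Theta_T\int_0^T\left(\dot h_t-(\operatorname{div}Z)(X_t(x))h_t\right)\Theta_t^{-1}\,dB_t\Bigr\rangle\right],$$ where $\Theta$ is the $\operatorname{Aut}(T_xM)$-valued process defined by $$\frac{d}{dt}\Theta_t=-\,/\!/_t^{-1}\left(\operatorname{Ric}^\sharp+(\nabla_{\bullet}Z)^{*}-\operatorname{div}Z\right)/\!/_t\,\Theta_t,\qquad \Theta_0=\mathrm{id}_{T_xM}.$$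
   Context: $P_Tg(x)=\mathbb{E}[g(X_T(x))]$ is the semigroup generated by $\Delta+Z$, and $V(f)=df(V)$. $\nabla$ is the Levi-Civita connection, $\operatorname{Ric}^\sharp v=\operatorname{Ric}(v,\cdot)^\sharp$, and $(\nabla_\bullet Z)^*$ is the fibrewise adjoint of the endomorphism $v\mapsto\nabla_vZ$ of $TM$; $\operatorname{div}Z=\operatorname{trace}(v\mapsto\nabla_vZ)$ acts by multiplication, and $\operatorname{div}\alpha=\operatorname{div}\alpha^\sharp$ for a 1-form $\alpha$. The diffusion is constructed as $X_t(x)=\pi(U_t)$, where $\pi:O(M)\to M$ is the orthonormal frame bundle and $U$ solves the Stratonovich equation $dU_t=\sum_{i=1}^nH_i(U_t)\circ dB^i_t+\bar Z(U_t)\,dt$, $\pi(U_0)=x$, with $H_i$ the standard horizontal vector fields, $\bar Z$ the horizontal lift of $Z$, and $(B^i)$ an $\mathbb{R}^n$-valued Brownian motion sped up by $2$, i.e. $dB^i_t\,dB^j_t=2\delta_{ij}\,dt$. Parallel transport along $X$ is $/\!/_t=U_tU_0^{-1}:T_xM\to T_{X_t(x)}M$. In the formulas, $B$ is regarded as the $T_xM$-valued process $U_0B$ (the martingale part of the antidevelopment of $X(x)$ to $T_xM$). $L^{1,2}([0,T];\mathbb{R})$ is the Cameron-Martin space of absolutely continuous paths with square-integrable derivative. $(\alpha_t)_{0\le t\le T}$ is a time-dependent 1-form on $M$ with $\alpha_0=\alpha$ satisfying $$\frac{d}{dt}\alpha_t=\left(\square+\nabla_Z-\operatorname{Ric}^{*}_{-Z}+\operatorname{div}Z\right)\alpha_t,$$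 where $\square=\operatorname{trace}\nabla^2$ is the connection Laplacian on 1-forms and $\operatorname{Ric}^{*}_{-Z}$ acts on a 1-form $\phi$ by $\phi\mapsto\phi\circ(\operatorname{Ric}^\sharp+(\nabla_\bullet Z)^* )$. In the martingale, $\alpha_{T-t}$ is evaluated at $X_t(x)$. *)

(* Defs.v *)
From HB Require Import structures.
From mathcomp Require Import all_boot all_order all_algebra.
From mathcomp Require Import all_classical all_reals all_analysis.

Set Implicit Arguments.
Unset Strict Implicit.
Unset Printing Implicit Defensive.

Import Order.TTheory GRing.Theory Num.Theory.
Import numFieldNormedType.Exports.
Local Open Scope classical_set_scope.
Local Open Scope ring_scope.

Section Calculus.
Context {R : realType}.

(* f is C^k on the open set U: all iterated directional derivatives up to
   order k exist and are continuous on U.  On the finite-dimensional spaces E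
   used below this is the usual notion. *)
Fixpoint Ck (E : normedModType R) (k : nat) (U : set E) (f : E -> R) : Prop :=
  (forall y, U y -> {for y, continuous f}) /\
  (if k is k'.+1 then
     forall v, (forall y, U y -> derivable f y v) /\ Ck k' U (fun y => 'D_v f y)
   else True).

Definition smooth_on (E : normedModType R) (U : set E) (f : E -> R) : Prop :=
  forall k, Ck k U f.

(* At 0 and T the derivative is one-sided. *)
Definition has_derivative_on (E : normedModType R) (T : R) (f : R -> E) (t : R)
    (df : E) : Prop :=
  (fun h => h^-1 *: (f (t + h) - f t)) @
    within [set h | 0 <= t + h <= T] 0^' --> df.

Definition absolutely_continuous_on (a b : R) (f : R -> R) : Prop :=
  forall eps, 0 < eps -> exists2 del, 0 < del &
    forall (m : nat) (u v : nat -> R),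
      (forall k, (k < m)%N -> a <= u k /\ u k <= v k /\ v k <= b) ->
      (forall k, (k.+1 < m)%N -> v k <= u k.+1) ->
      \sum_(k < m) (v k - u k) < del ->
      \sum_(k < m) `|f (v k) - f (u k)| < eps.

(* The derivative of an absolutely continuous path exists almost everywhere;
   the value of derive1 f on the remaining null set is irrelevant. *)
Definition cameron_martin (T : R) (f : R -> R) : Prop :=
  absolutely_continuous_on 0 T f /\
  (\int[lebesgue_measure]_(s in `[0%R, T]) ((derive1 f s ^+ 2)%R)%:E < +oo)%E.

End Calculus.

(* A smooth structure is given by a smooth atlas containing a distinguished
   chart around each point p: a homeomorphism cmap p from the open set cdom p
   onto an open subset of R^n, with inverse cinv p. *)
Record manifold (R : realType) (n : nat) (M : topologicalType) := Manifold {
  cdom : M -> set M ;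
  cmap : M -> M -> 'cV[R]_n ;
  cinv : M -> 'cV[R]_n -> M ;
  cdom_open : forall p, open (cdom p) ;
  cdom_self : forall p, cdom p p ;
  cimg_open : forall p, open (cmap p @` cdom p) ;
  cmapK : forall p x, cdom p x -> cinv p (cmap p x) = x ;
  cmap_continuous : forall p x, cdom p x -> {for x, continuous (cmap p)} ;
  cinv_continuous : forall p y, (cmap p @` cdom p) y ->
    {for y, continuous (cinv p)} ;
  transition_smooth : forall p q i,
    smooth_on (cmap p @` (cdom p `&` cdom q))
      (fun y => cmap q (cinv p y) i 0) ;
  manifold_hausdorff : hausdorff_space M ;
  manifold_second_countable : @second_countable M
}.

(* The tangent space at x is identified with R^n through the distinguished
   chart at x.  Hence a vector field is a function M -> 'cV_n, a 1-form a
   function M -> 'rV_n, and an endomorphism of T_xM an n x n matrix, all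
   expressed in the coordinate basis of the chart at the base point. *)
Section TensorFields.
Context {R : realType} {n : nat} {M : topologicalType} (A : manifold R n M).

Definition cimg (p : M) : set 'cV[R]_n := cmap A p @` cdom A p.

(* The differential at x of the change of coordinates from the chart at p to
   the chart at q. *)
Definition Jac (p q x : M) : 'M[R]_n :=
  \matrix_(i, j) 'D_(delta_mx j 0) (fun y => cmap A q (cinv A p y) i 0)
                   (cmap A p x).

(* Components in the chart at p, as functions of the coordinates y. *)
Definition vloc (V : M -> 'cV[R]_n) (p : M) (y : 'cV[R]_n) : 'cV[R]_n :=
  let x := cinv A p y in Jac x p x *m V x.

Definition floc (a : M -> 'rV[R]_n) (p : M) (y : 'cV[R]_n) : 'rV[R]_n :=
  let x := cinv A p y in a x *m Jac p x x.

Definition bloc (b : M -> 'M[R]_n) (p : M) (y : 'cV[R]_n) : 'M[R]_n :=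
  let x := cinv A p y in (Jac p x x)^T *m b x *m Jac p x x.

Definition smooth_function (f : M -> R) : Prop :=
  forall p, smooth_on (cimg p) (f \o cinv A p).

Definition smooth_vector_field (V : M -> 'cV[R]_n) : Prop :=
  forall p i, smooth_on (cimg p) (fun y => vloc V p y i 0).

Definition smooth_form (a : M -> 'rV[R]_n) : Prop :=
  forall p i, smooth_on (cimg p) (fun y => floc a p y 0 i).

Definition pd (i : 'I_n) (f : 'cV[R]_n -> R) (y : 'cV[R]_n) : R :=
  'D_(delta_mx i 0) f y.

Definition dfun (f : M -> R) (x : M) : 'rV[R]_n :=
  \row_i pd i (f \o cinv A x) (cmap A x x).

(* V(f) = df(V) *)
Definition lie (V : M -> 'cV[R]_n) (f : M -> R) (x : M) : R :=
  (dfun f x *m V x) 0 0.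

End TensorFields.

Record riemannian (R : realType) (n : nat) (M : topologicalType)
    (A : manifold R n M) := Riemannian {
  metric : M -> 'M[R]_n ;
  metric_sym : forall x, (metric x)^T = metric x ;
  metric_pos : forall x (v : 'cV[R]_n), v != 0 ->
    0 < (v^T *m metric x *m v) 0 0 ;
  metric_smooth : forall p i j,
    smooth_on (cimg A p) (fun y => bloc A metric p y i j)
}.

Section RiemannianGeometry.
Context {R : realType} {n : nat} {M : topologicalType}.
Context (A : manifold R n M) (g : riemannian A).

Definition inner (x : M) (v w : 'cV[R]_n) : R := (v^T *m metric g x *m w) 0 0.

Definition flat (V : M -> 'cV[R]_n) (x : M) : 'rV[R]_n :=
  (V x)^T *m metric g x.

Definition sharp (a : M -> 'rV[R]_n) (x : M) : 'cV[R]_n :=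
  invmx (metric g x) *m (a x)^T.

Definition adjoint (x : M) (L : 'M[R]_n) : 'M[R]_n :=
  invmx (metric g x) *m L^T *m metric g x.

Definition gloc : M -> 'cV[R]_n -> 'M[R]_n := bloc A (metric g).

(* The Christoffel symbol Gamma^k_ij of the Levi-Civita connection in the
   chart at p. *)
Definition christoffel (p : M) (k i j : 'I_n) (y : 'cV[R]_n) : R :=
  2^-1 * \sum_l invmx (gloc p y) k l *
    (pd i (fun z => gloc p z j l) y + pd j (fun z => gloc p z i l) y
     - pd l (fun z => gloc p z i j) y).

(* The endomorphism v |-> nabla_v V of T_xM. *)
Definition nabla (V : M -> 'cV[R]_n) (x : M) : 'M[R]_n :=
  \matrix_(k, i) (pd i (fun y => vloc A V x y k 0) (cmap A x x)
    + \sum_j christoffel x k i j (cmap A x x) * V x j 0).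

Definition div (V : M -> 'cV[R]_n) (x : M) : R := \tr (nabla V x).

Definition div_form (a : M -> 'rV[R]_n) : M -> R := div (sharp a).

(* R(d_i, d_j) d_k = \sum_l riemann p l k i j d_l *)
Definition riemann (p : M) (l k i j : 'I_n) (y : 'cV[R]_n) : R :=
  pd i (christoffel p l j k) y - pd j (christoffel p l i k) y
  + \sum_m (christoffel p l i m y * christoffel p m j k y
            - christoffel p l j m y * christoffel p m i k y).

(* Ric(d_j, d_k) = trace (v |-> R(v, d_j) d_k) *)
Definition ricci (p : M) (j k : 'I_n) (y : 'cV[R]_n) : R :=
  \sum_i riemann p i k i j y.

Definition ricci_sharp (x : M) : 'M[R]_n :=
  invmx (metric g x) *m \matrix_(k, j) ricci x j k (cmap A x x).

(* (nabla_{d_j} a)(d_k) in the chart at p *)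
Definition cov (a : M -> 'rV[R]_n) (p : M) (j k : 'I_n) (y : 'cV[R]_n) : R :=
  pd j (fun z => floc A a p z 0 k) y
  - \sum_m christoffel p m j k y * floc A a p y 0 m.

(* (nabla^2_{d_i, d_j} a)(d_k) in the chart at p *)
Definition cov2 (a : M -> 'rV[R]_n) (p : M) (i j k : 'I_n) (y : 'cV[R]_n) : R :=
  pd i (cov a p j k) y
  - \sum_m christoffel p m i j y * cov a p m k y
  - \sum_m christoffel p m i k y * cov a p j m y.

Definition connection_laplacian (a : M -> 'rV[R]_n) (x : M) : 'rV[R]_n :=
  \row_k \sum_i \sum_j invmx (metric g x) i j * cov2 a x i j k (cmap A x x).

Definition nabla_form (Z : M -> 'cV[R]_n) (a : M -> 'rV[R]_n) (x : M) :
    'rV[R]_n :=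
  \row_k \sum_j Z x j 0 * cov a x j k (cmap A x x).

(* square + nabla_Z - Ric^*_{-Z} + div Z, acting on 1-forms *)
Definition form_generator (Z : M -> 'cV[R]_n) (a : M -> 'rV[R]_n) (x : M) :
    'rV[R]_n :=
  connection_laplacian a x + nabla_form Z a x
  - a x *m (ricci_sharp x + adjoint x (nabla Z x)) + div Z x *: a x.

Definition geodesic (c : R -> M) : Prop :=
  continuous c /\
  forall p t, cdom A p (c t) ->
    let y := fun s => cmap A p (c s) in
    [/\ \forall s \near t, derivable y s 1,
        derivable (derive1 y) t 1 &
        forall k, derive1 (derive1 y) t k 0
          + \sum_i \sum_j christoffel p k i j (y t)
                          * derive1 y t i 0 * derive1 y t j 0 = 0].

Definition geodesically_complete : Prop :=
  forall (x : M) (v : 'cV[R]_n), exists c : R -> M,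
    [/\ geodesic c, c 0 = x & derive1 (fun s => cmap A x (c s)) 0 = v].

(* A frame at x is a pair (x, e) whose columns col i e form a basis of T_xM;
   it stands for the isomorphism R^n -> T_xM with matrix e. *)
Definition orthonormal_frame (u : M * 'M[R]_n) : Prop :=
  u.2^T *m metric g u.1 *m u.2 = 1%:M.

Definition frame_coord (p : M) (u : M * 'M[R]_n) : 'M[R]_n :=
  Jac A u.1 p u.1 *m u.2.

Definition frloc (F : M * 'M[R]_n -> R) (p : M) (z : 'cV[R]_n * 'M[R]_n) : R :=
  let x := cinv A p z.1 in F (x, Jac A p x x *m z.2).

(* The topology of the frame bundle, read in the bundle charts. *)
Definition frame_open (O : set (M * 'M[R]_n)) : Prop :=
  forall p, open [set z : 'cV[R]_n * 'M[R]_n |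
    let x := cinv A p z.1 in
    [/\ cimg A p z.1, z.2 \in unitmx & O (x, Jac A p x x *m z.2)]].

(* Smooth functions on the bundle of linear frames.  O(M) is a closed
   submanifold of it, so its smooth functions are the restrictions of these. *)
Definition smooth_frame_function (F : M * 'M[R]_n -> R) : Prop :=
  forall p, smooth_on [set z | cimg A p z.1 /\ z.2 \in unitmx] (frloc F p).

(* The derivative of F at the frame u = (x, e) along the horizontal lift of
   v in T_xM, that is
   v^i d/dx^i - Gamma^k_ij v^i e^j_m d/de^k_m.
   This vector is tangent to O(M) when u is orthonormal. *)
Definition horizontal_derivative (F : M * 'M[R]_n -> R) (v : 'cV[R]_n)
    (u : M * 'M[R]_n) : R :=
  let x := u.1 in
  'D_(v, - \matrix_(k, m)
         \sum_i \sum_j christoffel x k i j (cmap A x x) * v i 0 * u.2 j m)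
    (frloc F x) (cmap A x x, u.2).

Definition std_horizontal (i : 'I_n) (F : M * 'M[R]_n -> R)
    (u : M * 'M[R]_n) : R :=
  horizontal_derivative F (col i u.2) u.

Definition horizontal_lift (Z : M -> 'cV[R]_n) (F : M * 'M[R]_n -> R)
    (u : M * 'M[R]_n) : R :=
  horizontal_derivative F (Z u.1) u.

End RiemannianGeometry.

Section StochasticProcesses.
Context {R : realType} {d : measure_display} {Om : measurableType d}.
Context (P : probability Om R).

Record filtration := Filtration {
  filt :> R -> set (set Om) ;
  filt_sigma : forall t, 0 <= t -> sigma_algebra setT (filt t) ;
  filt_sub : forall t, 0 <= t -> filt t `<=` measurable ;
  filt_mono : forall s t, 0 <= s -> s <= t -> filt s `<=` filt t
}.

Context (FF : filtration).

Definition measurable_wrt (G : set (set Om)) (X : Om -> R) : Prop :=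
  forall C : set R, measurable C -> G (X @^-1` C).

Definition adapted_on (D : set R) (X : R -> Om -> R) : Prop :=
  forall t, D t -> measurable_wrt (FF t) (X t).

Definition adapted_mx_on (D : set R) (m k : nat) (X : R -> Om -> 'M[R]_(m, k)) :
    Prop :=
  forall i j, adapted_on D (fun t w => X t w i j).

Definition continuous_paths (E : topologicalType) (X : R -> Om -> E) : Prop :=
  {ae P, forall w, {within `[0, +oo[, continuous (X ^~ w)}}.

(* E[X_t | F_s] = X_s is spelled out by integrating over the events of F_s. *)
Definition martingale (T : R) (X : R -> Om -> R) : Prop :=
  [/\ adapted_on `[0, T] X,
      forall t, 0 <= t <= T -> P.-integrable setT (EFin \o X t) &
      forall s t, 0 <= s -> s <= t -> t <= T -> forall E, FF s E ->
        (\int[P]_(w in E) (X t w)%:E = \int[P]_(w in E) (X s w)%:E)%E].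

Definition local_martingale (X : R -> Om -> R) : Prop :=
  adapted_on `[0, +oo[ X /\
  exists tau : nat -> Om -> R,
    [/\ forall k w, 0 <= tau k w /\ tau k w <= tau k.+1 w,
        forall k t, 0 <= t -> FF t [set w | tau k w <= t],
        {ae P, forall w, forall t, exists k, t <= tau k w} &
        forall k T, 0 <= T ->
          martingale T (fun t w => X (Num.min t (tau k w)) w - X 0 w)].

Definition continuous_semimartingale (Y : R -> Om -> R) : Prop :=
  adapted_on `[0, +oo[ Y /\
  exists N V : R -> Om -> R,
    [/\ continuous_paths N /\ local_martingale N,
        continuous_paths V /\ adapted_on `[0, +oo[ V,
        {ae P, forall w, forall t, 0 <= t -> bounded_variation 0 t (V ^~ w)} &
        {ae P, forall w, forall t, 0 <= t -> Y t w = Y 0 w + N t w + V t w}].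

(* An R^k-valued Brownian motion for the filtration, with
   d<B^i, B^j>_t = 2 delta_ij dt: B_t - B_s is independent of F_s, with
   independent centred Gaussian components of variance 2 (t - s)
   (the second parameter of normal_prob is the standard deviation). *)
Definition brownian_motion2 (k : nat) (B : R -> Om -> 'cV[R]_k) : Prop :=
  [/\ adapted_mx_on `[0, +oo[ B,
      continuous_paths B,
      forall w, B 0 w = 0 &
      forall s t, 0 <= s -> s < t -> forall E, FF s E ->
        forall C : 'I_k -> set R, (forall i, measurable (C i)) ->
        P (E `&` [set w | forall i, C i (B t w i 0 - B s w i 0)])
        = (P E * (\prod_i fine (normal_prob 0 (Num.sqrt (2 * (t - s))) (C i)))%:E)%E].

Definition trapezoid_sum (Y X : R -> Om -> R) (r : seq R) (w : Om) : R :=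
  let s k := nth 0 (0 :: r) k in
  \sum_(k < size r) 2^-1 * (Y (s k) w + Y (s k.+1) w)
                    * (X (s k.+1) w - X (s k) w).

(* S is the Stratonovich integral of Y against X: the limit in probability of
   the trapezoidal sums along partitions of [0, t] whose mesh tends to 0. *)
Definition stratonovich_integral (Y X S : R -> Om -> R) : Prop :=
  [/\ continuous_semimartingale Y,
      continuous_paths S, adapted_on `[0, +oo[ S &
      forall t eps, 0 <= t -> 0 < eps -> exists2 del, 0 < del &
        forall r, itv_partition 0 t r ->
          (forall k, (k < size r)%N ->
            nth 0 (0 :: r) k.+1 - nth 0 (0 :: r) k < del) ->
          (P [set w | (eps <= `|trapezoid_sum Y X r w - S t w|)%R] < eps%:E)%E].

(* The process \sum_(k < N) xi_k 1_(s_k, s_(k+1)] *)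
Record simple_process (m k : nat) := SimpleProcess {
  sp_size : nat ;
  sp_time : nat -> R ;
  sp_val : nat -> Om -> 'M[R]_(m, k) ;
  sp_time_ge0 : forall l, 0 <= sp_time l ;
  sp_time_mono : forall l, sp_time l <= sp_time l.+1 ;
  sp_val_meas : forall l i j,
    measurable_wrt (FF (sp_time l)) (fun w => sp_val l w i j) ;
  sp_val_bounded : forall l, exists c, forall w i j, `|sp_val l w i j| <= c
}.

Definition sp_eval (m k : nat) (H : simple_process m k) (t : R) (w : Om) :
    'M[R]_(m, k) :=
  \sum_(l < sp_size H)
    if sp_time H l < t <= sp_time H l.+1 then sp_val H l w else 0.

Definition sp_integral (m k : nat) (H : simple_process m k)
    (X : R -> Om -> 'cV[R]_k) (t : R) (w : Om) : 'cV[R]_m :=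
  \sum_(l < sp_size H) sp_val H l w
    *m (X (Num.min t (sp_time H l.+1)) w - X (Num.min t (sp_time H l)) w).

(* I is the Ito integral of Phi against X on [0, T], where d<X> has a bounded
   density and \int_0^T |Phi_s|^2 ds is almost surely finite: the integrals of
   some simple adapted processes converging to Phi in L^2([0, T]) converge to I
   uniformly on [0, T], almost surely.  Almost sure convergence here is
   equivalent to convergence in probability, by passing to a subsequence. *)
Definition ito_integral (m k : nat) (T : R) (Phi : R -> Om -> 'M[R]_(m, k))
    (X : R -> Om -> 'cV[R]_k) (I : R -> Om -> 'cV[R]_m) : Prop :=
  adapted_mx_on `[0, T] I /\
  exists H : nat -> simple_process m k, {ae P, forall w,
    [/\ forall i j, measurable_fun `[0, T] (fun t => Phi t w i j),
        (fun l => \int[lebesgue_measure]_(t in `[0%R, T])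
           (\sum_i \sum_j (sp_eval (H l) t w i j - Phi t w i j) ^+ 2)%:E)%E
          @ \oo --> 0%E &
        forall eps, 0 < eps -> \forall l \near \oo, forall t, 0 <= t <= T ->
          `|sp_integral (H l) X t w - I t w| <= eps]}.

(* P_t g (x) = E[g(X_t(x))] *)
Definition semigroup (M : Type) (X : R -> Om -> M) (t : R) (g : M -> R) : \bar R :=
  'E_P[fun w => g (X t w)].

End StochasticProcesses.

Section HorizontalDiffusion.
Context {R : realType} {n : nat} {M : topologicalType} {A : manifold R n M}.
Context (g : riemannian A).
Context {d : measure_display} {Om : measurableType d} (P : probability Om R).
Context (FF : @filtration R d Om).

(* U solves dU = \sum_i H_i(U) o dB^i + Zbar(U) dt in O(M) with pi(U_0) = x
   and infinite lifetime.  Equality of the two sides is tested against the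
   smooth functions on the frame bundle. *)
Definition horizontal_diffusion (Z : M -> 'cV[R]_n) (x : M)
    (B : R -> Om -> 'cV[R]_n) (U : R -> Om -> M * 'M[R]_n) : Prop :=
  [/\ forall w, (U 0 w).1 = x,
      forall t w, 0 <= t -> orthonormal_frame g (U t w),
      forall t O, 0 <= t -> frame_open A O -> FF t (U t @^-1` O),
      {ae P, forall w,
        {within `[0, +oo[, continuous (fun t => (U t w).1)} /\
        forall p t, 0 <= t -> cdom A p (U t w).1 ->
          (fun s => frame_coord A p (U s w)) @ within `[0, +oo[ (nbhs t)
            --> frame_coord A p (U t w)} &
      forall F, smooth_frame_function A F ->
        exists S : 'I_n -> R -> Om -> R,
          (forall i, stratonovich_integral P FF
             (fun t w => std_horizontal g i F (U t w))
             (fun t w => B t w i 0) (S i)) /\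
          {ae P, forall w, forall t, 0 <= t ->
             F (U t w) = F (U 0 w) + \sum_i S i t w
               + \int[lebesgue_measure]_(s in `[0, t])
                   horizontal_lift g Z F (U s w)}].

(* The matrix of U_t U_0^-1 : T_xM -> T_(X_t)M *)
Definition parallel_transport (U : R -> Om -> M * 'M[R]_n) (t : R) (w : Om) :
    'M[R]_n :=
  (U t w).2 *m invmx (U 0 w).2.

End HorizontalDiffusion.

(* Main.v *)
Require Import Defs.
From HB Require Import structures.
From mathcomp Require Import all_boot all_order all_algebra.
From mathcomp Require Import all_classical all_reals all_analysis.
From mathcomp Require Import measurable_realfun.

Import Order.TTheory GRing.Theory Num.Theory.
Import numFieldNormedType.Exports.
Local Open Scope classical_set_scope.
Local Open Scope ring_scope.

(** The martingale of the statement turns the formula into a comparison of two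
    expectations.  At time [0] it vanishes almost surely, because [h_0 = 0] and
    the stochastic integral starts at [0] ([ito_integral0]); hence its value at
    time [T] has mean [0].  Since [h_T = 1] and [alpha_0 = (fV)^flat], that
    value is almost surely
      [div (fV)(X_T) - 1/2 f(X_T) <V(X_T), //_T Theta_T I_T>],
    and the Leibniz rule [div (fV) = V(f) + f div V] ([div_scale]), with
    [sharp] inverse to [flat] ([flatK]), gives the formula after taking
    expectations ([expectation_of_balance]).

    What needs an argument is that the expectation may be split, that is, that
    the separate terms have measurable versions.  Frames are measured through
    the bundle charts.  The components of the smooth form [alpha_0] in the
    frame [U_T] are continuous on the frame bundle, so the pairing with
    [//_T Theta_T I_T] is measurable once [U_0] is; the latter amounts to the
    continuity of the coordinates of a frame in a fixed chart, which rests on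
    the cocycle identity [Jac_comp], that is, on the chain rule.  As the
    smoothness at hand is stated through directional derivatives, the chain
    rule is obtained from the mean value theorem coordinate by coordinate
    ([increment_partials], [derive_comp_partials]).  The remaining term
    [f div V] is then almost surely a combination of measurable ones, and an
    almost sure measurable version determines its integral
    ([integral_modification]). *)

(** * Directional derivatives and increments *)

Section DirectionalCalculus.
Context {R : realType} {E : normedModType R}.
Implicit Types (f : E -> R) (a v : E).

Lemma difference_quotient_line f a v s :
  (fun r : R => r^-1 *: (((fun q => f (a + q *: v)) \o shift s) (r *: 1)
                        - f (a + s *: v)))
  = (fun r : R => r^-1 *: ((f \o shift (a + s *: v)) (r *: v) - f (a + s *: v))).
Proof.
apply/funext => r /=; congr (_ *: (f _ - _)).
by rewrite [r *: 1]mulr1 scalerDl addrCA.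
Qed.

Lemma derive_line f a v s :
  'D_1 (fun r : R => f (a + r *: v)) s = 'D_v f (a + s *: v).
Proof. by rewrite /derive difference_quotient_line. Qed.

Lemma derivable_line f a v s :
  derivable (fun r : R => f (a + r *: v)) s 1 <-> derivable f (a + s *: v) v.
Proof. by rewrite /derivable difference_quotient_line. Qed.

(** The mean value theorem for [f] restricted to the segment from [a] to
    [a + v]; the parametrization by the unit interval makes it insensitive to
    the sign of the coordinates of [v]. *)
Lemma mean_value_line f a v :
  (forall s, 0 <= s <= 1 -> derivable f (a + s *: v) v) ->
  exists2 s, 0 <= s <= 1 & f (a + v) - f a = 'D_v f (a + s *: v).
Proof.
move=> fv.
have [s s01|s|s s01 e] := @MVT_segment R (fun r => f (a + r *: v))
  (fun r => 'D_v f (a + r *: v)) 0 1 ler01.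
- split; last exact: derive_line.
  apply/derivable_line/fv; move: s01; rewrite in_itv /= => /andP[s0 s1].
  by rewrite !ltW.
- apply: derivable_within_continuous => r; rewrite in_itv /= => r01.
  exact/derivable_line/fv.
- exists s; first by rewrite in_itv in s01.
  by move: e; rewrite scale1r scale0r addr0 subr0 mulr1.
Qed.

Lemma derive_scale_direction f a v (t : R) :
  derivable f a v -> 'D_(t *: v) f a = t * 'D_v f a.
Proof.
move=> fv.
have D0 w : 'D_w f a = 'D_1 (fun r : R => f (a + r *: w)) 0.
  by rewrite derive_line scale0r addr0.
have fl : derivable (fun r : R => f (a + r *: v)) (0 * t) 1.
  by apply/derivable_line; rewrite mul0r scale0r addr0.
have id1 : derivable (id : R -> R) 0 1 := @derivable_id _ _ _ _.
have tl : derivable ( *%R^~ t : R -> R) 0 1.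
  exact: (derivableM id1 (derivable_cst _ _ _)).
have line_scale : (fun r : R => f (a + r *: (t *: v)))
    = (fun r : R => f (a + r *: v)) \o ( *%R^~ t).
  by apply/funext => r /=; rewrite scalerA.
rewrite D0 line_scale -derive1E (derive1_comp tl fl).
rewrite [X in X * _]derive1E derive_line mul0r scale0r addr0 mulrC.
by rewrite (derive1Mr t id1) derive1_id mul1r.
Qed.

End DirectionalCalculus.

Section ContinuouslyDifferentiable.
Context {R : realType} {n : nat}.
Implicit Types (f : 'cV[R]_n -> R) (a b : 'cV[R]_n).

Lemma coord_le_norm b i : `|b i 0| <= `|b|.
Proof.
rewrite [leRHS]/Num.Def.normr/= mx_normrE.
exact: (le_bigmax _ (fun ij => `|b ij.1 ij.2|) (i, 0)).
Qed.

Lemma norm_le_coord b (c : R) : 0 <= c -> (forall i, `|b i 0| <= c) -> `|b| <= c.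
Proof.
move=> c0 bc; rewrite [leLHS]/Num.Def.normr/= mx_normrE.
by apply: bigmax_le => // -[i j] _; rewrite /= ord1.
Qed.

(** The corners of the staircase from [a] to [b]: consecutive corners differ in
    one coordinate, so that each step of the staircase sees one partial
    derivative. *)
Definition splice a b k : 'cV[R]_n := \col_i if (i < k)%N then b i 0 else a i 0.

Lemma splice_step a b (k : 'I_n) :
  splice a b k.+1 = splice a b k + (b k 0 - a k 0) *: delta_mx k 0.
Proof.
apply/matrixP => i j; rewrite !mxE ord1 eqxx andbT ltnS leq_eqVlt.
have [->|ik] := eqVneq i k; first by rewrite eqxx ltnn mulr1 subrKC.
by rewrite -val_eqE in ik; rewrite (negbTE ik) mulr0 addr0.
Qed.

(** Telescoping along the staircase and applying the mean value theorem to each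
    step expresses an increment through partial derivatives at nearby points.
    This substitutes for Frechet differentiability: once the partial
    derivatives are continuous, the points [xi k] may be moved to [a]. *)
Lemma increment_partials f a (r : R) :
  (forall y, `|y - a| < r -> forall v, derivable f y v) ->
  forall b, `|b - a| < r -> exists xi : 'I_n -> 'cV[R]_n,
    (forall k, `|xi k - a| <= `|b - a|) /\
    f b - f a = \sum_k (b k 0 - a k 0) * 'D_(delta_mx k 0) f (xi k).
Proof.
move=> fd b br.
have step (k : 'I_n) : exists2 xi : 'cV[R]_n, `|xi - a| <= `|b - a| &
    f (splice a b k.+1) - f (splice a b k)
    = (b k 0 - a k 0) * 'D_(delta_mx k 0) f xi.
  have near_a s : 0 <= s <= 1 ->
      `|splice a b k + s *: ((b k 0 - a k 0) *: delta_mx k 0) - a| <= `|b - a|.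
    move=> /andP[s0 s1]; apply: norm_le_coord => // i.
    apply: le_trans (coord_le_norm (b - a) i); rewrite !mxE eqxx andbT.
    have [->|ik] := eqVneq i k; last first.
      by rewrite !mulr0 addr0; case: ifP => // _; rewrite subrr normr0.
    rewrite ltnn mulr1 addrAC subrr add0r normrM ger0_norm//.
    by rewrite ler_piMl.
  have [s s01 e] := mean_value_line f (splice a b k)
    ((b k 0 - a k 0) *: delta_mx k 0)
    (fun s s01 => fd _ (le_lt_trans (near_a s s01) br) _).
  exists (splice a b k + s *: ((b k 0 - a k 0) *: delta_mx k 0)).
    exact: near_a.
  rewrite splice_step e derive_scale_direction//.
  exact/fd/(le_lt_trans (near_a s s01)).
pose xi k := sval (cid2 (step k)).
exists xi; split=> [k|]; first by rewrite /xi; case: cid2.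
have -> : f b - f a = f (splice a b n) - f (splice a b 0).
  by congr (f _ - f _); apply/matrixP => i j; rewrite !mxE ord1// ltn_ord.
rewrite -(telescope_sumr (fun k => f (splice a b k)))// big_mkord.
by apply: eq_bigr => k _; rewrite /xi; case: cid2.
Qed.

End ContinuouslyDifferentiable.

Section ChainRule.
Context {R : realType} {n : nat} {E : normedModType R}.

(** The chain rule for an outer function whose partial derivatives are
    continuous.  Write the increment of [f] by [increment_partials] and divide
    by the step: the coordinates of [phi] contribute their difference quotients,
    and the intermediate points converge to [phi a], being no farther from it
    than [phi (h *: v + a)]. *)
Lemma derive_comp_partials (phi : E -> 'cV[R]_n) (f : 'cV[R]_n -> R) (a v : E) :
  (forall k, derivable (fun y => phi y k 0) a v) ->
  (\forall y \near phi a, forall w, derivable f y w) ->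
  (forall k, {for phi a, continuous ('D_(delta_mx k 0) f)}) ->
  'D_v (f \o phi) a
  = \sum_k 'D_v (fun y => phi y k 0) a * 'D_(delta_mx k 0) f (phi a).
Proof.
move=> dphi /nbhs_ballP[r /= r0 fr] cf.
have fd y : `|y - phi a| < r -> forall w, derivable f y w.
  by move=> yr; apply: fr; rewrite -ball_normE /ball_/= distrC.
have [xi xiP] : {xi : 'cV[R]_n -> 'I_n -> 'cV[R]_n &
    forall b, `|b - phi a| < r ->
      (forall k, `|xi b k - phi a| <= `|b - phi a|) /\
      f b - f (phi a)
      = \sum_k (b k 0 - phi a k 0) * 'D_(delta_mx k 0) f (xi b k)}.
  apply: (@choice _ _ (fun b xi => `|b - phi a| < r ->
      (forall k, `|xi k - phi a| <= `|b - phi a|) /\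
      f b - f (phi a)
      = \sum_k (b k 0 - phi a k 0) * 'D_(delta_mx k 0) f (xi k))) => b.
  have [br|nbr] := pselect (`|b - phi a| < r); last by exists (fun=> 0).
  by have [x xP] := increment_partials f (phi a) r fd b br; exists x.
pose line (h : R) := phi (h *: v + a).
have line0 : line h @[h --> 0^'] --> phi a.
  have dl : derivable line 0 1.
    apply: (derivable1P phi a v).1; apply/derivable_mxP => i j.
    by rewrite ord1; exact: dphi.
  suff line_cts : line @ (0 : R) --> phi a.
    exact: cvg_trans (cvg_app line (@cvg_within _ _ _ _)) line_cts.
  have {1}<- : line 0 = phi a by rewrite /line scale0r add0r.
  exact/differentiable_continuous/(derivable1_diffP line 0).
have near_r : \forall h \near 0^', `|line h - phi a| < r.
  have /cvgrPdist_lt/(_ r r0) := line0.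
  by apply: filterS => h; rewrite distrC.
apply: cvg_lim => //.
apply: cvg_trans; last first.
  apply: (@cvg_big _ _ +%R 0 xpredT add_continuous R 0^' (index_enum 'I_n)
    (fun k h => h^-1 *: (line h k 0 - phi a k 0)
        * 'D_(delta_mx k 0) f (xi (line h) k))
    (fun k => 'D_v (fun y => phi y k 0) a * 'D_(delta_mx k 0) f (phi a))).
  move=> k _; apply: cvgM; first exact: dphi.
  apply: (@cvg_comp _ _ _ (fun h => xi (line h) k) ('D_(delta_mx k 0) f)
    _ (nbhs (phi a))); last exact: cf.
  apply/cvgrPdist_lt => e e0; near=> h.
  have [|xih _] := xiP (line h); first by near: h.
  rewrite distrC (le_lt_trans (xih k))// distrC.
  by near: h; move/cvgrPdist_lt : line0; apply.
apply: near_eq_cvg.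
near=> h.
have [|_ e] := xiP (line h); first by near: h.
rewrite /= -/(line h) [X in _ = _ *: X]e scaler_sumr.
by apply: eq_bigr => k _; rewrite -scalerAl.
Unshelve. all: by end_near. Qed.

End ChainRule.

(** * Coordinate changes *)

Section SmoothOn.
Context {R : realType} {E : normedModType R} {U : set E} {f : E -> R}.
Hypothesis fsmooth : smooth_on U f.

Lemma smooth_on_continuous y : U y -> {for y, continuous f}.
Proof. by have [fc _] := fsmooth 0; exact: fc. Qed.

Lemma smooth_on_derivable y v : U y -> derivable f y v.
Proof. by have [_ /(_ v)[fd _]] := fsmooth 1; exact: fd. Qed.

Lemma smooth_on_derive_continuous y v : U y -> {for y, continuous ('D_v f)}.
Proof. by have [_ /(_ v)[_ [fc _]]] := fsmooth 1; exact: fc. Qed.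

End SmoothOn.

Section Atlas.
Context {R : realType} {n : nat} {M : topologicalType} (A : manifold R n M).
Implicit Types p q r x : M.

Lemma cinvK {p y} : cimg A p y ->
  cmap A p (cinv A p y) = y /\ cdom A p (cinv A p y).
Proof. by move=> [x px <-]; rewrite cmapK. Qed.

Lemma cimg_cmap {p x} : cdom A p x -> cimg A p (cmap A p x).
Proof. by exists x. Qed.

Lemma near_cinv_in {p} {O : set M} {y} : open O -> cimg A p y -> O (cinv A p y) ->
  \forall z \near y, cimg A p z /\ O (cinv A p z).
Proof.
move=> oO py Oy; apply: filterI.
  by apply: open_nbhs_nbhs; split=> //; exact: cimg_open.
have cinv_y : {for y, continuous (cinv A p)} by exact: cinv_continuous.
by apply: cinv_y; apply: open_nbhs_nbhs.
Qed.

Lemma overlap_image p q :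
  cmap A p @` (cdom A p `&` cdom A q)
  = [set y | cimg A p y /\ cdom A q (cinv A p y)].
Proof.
apply/seteqP; split=> y /=; last by move=> [[x px <-]]; rewrite cmapK//; exists x.
by move=> [x [px qx] <-]; rewrite cmapK//; split=> //; exists x.
Qed.

Lemma Jac_id p x : cdom A p x -> Jac A p p x = 1%:M.
Proof.
move=> px; apply/matrixP => i j; rewrite !mxE.
rewrite (@near_eq_derive _ _ _ _ (fun y : 'cV[R]_n => y i 0)); last first.
  apply: filterS (near_cinv_in (cdom_open A p) (cimg_cmap px) _).
    by move=> z [pz _]; have [-> _] := cinvK pz.
  by rewrite /= cmapK.
have := derive_mx (@derivable_id _ _ (cmap A p x) (delta_mx j 0)).
move/matrixP/(_ i 0); rewrite derive_id !mxE eqxx andbT => <-.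
by [].
Qed.

(** The cocycle identity of coordinate changes: on the overlap of the three
    charts the transition from [p] to [r] is the composition of the transitions
    from [p] to [q] and from [q] to [r], so this is the chain rule.  It shows
    that coordinates of a frame in a fixed chart do not depend on the
    distinguished chart at its base point. *)
Lemma Jac_comp p q r x : cdom A p x -> cdom A q x -> cdom A r x ->
  Jac A q r x *m Jac A p q x = Jac A p r x.
Proof.
move=> px qx rx; apply/matrixP => i j; rewrite !mxE.
pose phi y := cmap A q (cinv A p y).
pose f y := cmap A r (cinv A q y) i 0.
have phix : phi (cmap A p x) = cmap A q x by rewrite /phi cmapK.
have pq_x : (cmap A p @` (cdom A p `&` cdom A q)) (cmap A p x) by exists x.
have qr_x : (cmap A q @` (cdom A q `&` cdom A r)) (cmap A q x) by exists x.
have sf : smooth_on (cmap A q @` (cdom A q `&` cdom A r)) f.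
  exact: transition_smooth.
transitivity ('D_(delta_mx j 0) (f \o phi) (cmap A p x)); last first.
  apply: near_eq_derive.
  apply: filterS (near_cinv_in (cdom_open A q) (cimg_cmap px) _).
    by move=> z [pz qz]; rewrite /f /phi /= cmapK.
  by rewrite /= cmapK.
rewrite derive_comp_partials; last 3 first.
- move=> k; exact: (smooth_on_derivable (transition_smooth A p q k)).
- rewrite phix; move: (qr_x); rewrite overlap_image => -[q_x r_x].
  apply: filterS (near_cinv_in (cdom_open A r) q_x r_x) => z zU w.
  by apply: (smooth_on_derivable sf); rewrite overlap_image.
- by move=> k; rewrite phix; exact: (smooth_on_derive_continuous sf).
by apply: eq_bigr => k _; rewrite !mxE phix mulrC.
Qed.

(** [Jac A p q x] is the derivative of the transition map at [cmap A p x], and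
    this point is [z] itself when [x = cinv A p z]. *)
Lemma Jac_continuous p q i j y : cimg A p y -> cdom A q (cinv A p y) ->
  {for y, continuous (fun z => Jac A p q (cinv A p z) i j)}.
Proof.
move=> py qy.
have Uy : (cmap A p @` (cdom A p `&` cdom A q)) y by rewrite overlap_image.
have JE z : cimg A p z ->
    'D_(delta_mx j 0) (fun y => cmap A q (cinv A p y) i 0) z
    = Jac A p q (cinv A p z) i j.
  by move=> pz; rewrite mxE; have [-> _] := cinvK pz.
rewrite /prop_for /continuous_at -(JE y py).
have dc := smooth_on_derive_continuous (transition_smooth A p q i)
  y (delta_mx j 0) Uy.
apply: (@cvg_trans _
  ('D_(delta_mx j 0) (fun y => cmap A q (cinv A p y) i 0) @ y)); last exact: dc.
have near_p := near_cinv_in (cdom_open A q) py qy.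
have near_JE : {near y,
    'D_(delta_mx j 0) (fun y => cmap A q (cinv A p y) i 0)
    =1 (fun z => Jac A p q (cinv A p z) i j)}.
  by apply: filterS near_p => z [pz _]; exact: JE.
exact: near_eq_cvg near_JE.
Qed.

End Atlas.

(** * The Leibniz rule for the divergence *)

Section Divergence.
Context {R : realType} {n : nat} {M : topologicalType} {A : manifold R n M}.
Context (g : riemannian A).

(** A positive definite form has trivial kernel. *)
Lemma metric_unit x : metric g x \in unitmx.
Proof.
rewrite -row_free_unit; apply: inj_row_free => v vg0.
apply/eqP; apply: contraT => v0.
have := @metric_pos _ _ _ _ g x v^T.
by rewrite trmxK vg0 mul0mx mxE ltxx trmx_eq0 => /(_ v0).
Qed.

Lemma flatK V : sharp g (flat g V) = V.
Proof.
apply/funext => x; rewrite /sharp /flat trmx_mul trmxK Defs.metric_sym.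
by rewrite mulKmx// metric_unit.
Qed.

(** The Leibniz rule for the divergence.  The Christoffel symbols enter [nabla]
    linearly in the field, so only the partial derivatives of the components see
    [f]; their trace contributes the extra term [V(f)]. *)
Lemma div_scale (f : M -> R) V x : smooth_function A f ->
  smooth_vector_field A V ->
  div g (fun y => f y *: V y) x = lie A V f x + f x * div g V x.
Proof.
move=> sf sV; have x_x := cimg_cmap A (cdom_self A x).
have cinvx : cinv A x (cmap A x x) = x by rewrite cmapK//; exact: cdom_self.
rewrite /div /lie !mxE mulr_sumr -big_split /=; apply: eq_bigr => i _.
have vlocE y : vloc A (fun y => f y *: V y) x y i 0
    = ((f \o cinv A x) * (fun y => vloc A V x y i 0)) y.
  by rewrite /vloc -scalemxAr mxE.
rewrite !mxE /pd (funext vlocE) deriveM; last 2 first.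
- exact: (smooth_on_derivable (sf x)).
- exact: (smooth_on_derivable (sV x i)).
(* At the base point the coordinate change is the identity. *)
have vlocx : vloc A V x (cmap A x x) = V x.
  by rewrite /vloc /= cinvx Jac_id ?mul1mx//; exact: cdom_self.
rewrite vlocx /= cinvx.
rewrite mulrDr mulr_sumr addrA [_ *: _ + _]addrC; congr (_ + _ + _).
  exact: mulrC.
by apply: eq_bigr => j _; rewrite mxE mulrCA.
Qed.

End Divergence.

(** * Continuous functions on the frame bundle *)

Section MatrixContinuity.
Context {R : realType} {n : nat}.

Lemma det_continuous : continuous (fun B : 'M[R]_n => \det B).
Proof.
move=> B; apply: (cvg_big add_continuous (nbhs_filter B)) => s _.
apply: cvgM; first exact: cvg_cst.
apply: (cvg_big mul_continuous (nbhs_filter B)) => i _.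
exact: coord_continuous.
Qed.

Lemma near_unitmx (B : 'M[R]_n) : B \in unitmx -> \forall C \near B, C \in unitmx.
Proof.
rewrite unitmxE unitfE => B0.
have det_neq0 := @cvgr_neq0 _ _ _ (nbhs B) (nbhs_filter B) _ _
  (det_continuous B) B0.
apply: (@filterS _ _ (nbhs_filter B) _ _ _ det_neq0) => C.
by rewrite unitmxE unitfE.
Qed.

End MatrixContinuity.

Section FrameFunctions.
Context {R : realType} {n : nat} {M : topologicalType} (A : manifold R n M).

(** Continuity in the bundle charts gives open sets of frames; restricting to
    frames based in [D] admits functions that make sense only over a part of
    [M], such as coordinates in one chart. *)
Lemma frame_open_preimage (D : set M) (W : set R) (F : M * 'M[R]_n -> R) :
  open D -> open W ->
  (forall p (z : 'cV[R]_n * 'M[R]_n), cimg A p z.1 -> D (cinv A p z.1) ->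
     {for z, continuous (frloc A F p)}) ->
  frame_open A [set u | D u.1 /\ W (F u)].
Proof.
move=> oD oW cF p; rewrite openE => z /= [pz uz [Dz Wz]].
have near_base : nbhs z [set y | cimg A p y.1 /\ D (cinv A p y.1)].
  exact: (cvg_fst (near_cinv_in A oD pz Dz)).
have near_frame : nbhs z [set y | y.2 \in unitmx].
  exact: (@cvg_snd _ _ (nbhs z.1) (nbhs z.2) (nbhs_filter z.1) _
    (near_unitmx z.2 uz)).
have near_value : nbhs z [set y | W (frloc A F p y)].
  by apply: (cF p z pz Dz); exact: open_nbhs_nbhs.
rewrite /interior.
apply: (@filterS _ _ (nbhs_filter z)); last first.
  exact: filterI near_base (filterI near_frame near_value).
by move=> y [[py Dy] [uy Wy]].
Qed.

(** Pairing a smooth form with the vectors of a frame does not depend on a chart: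
    in the chart at [p] both factors transform by the same matrix, which leaves
    the components of the form multiplied by those of the frame. *)
Lemma frloc_form_continuous (a : M -> 'rV[R]_n) (j : 'I_n) p z :
  smooth_form A a -> cimg A p z.1 ->
  {for z, continuous (frloc A (fun u => (a u.1 *m u.2) 0 j) p)}.
Proof.
move=> sa pz.
have -> : frloc A (fun u => (a u.1 *m u.2) 0 j) p
    = (fun z => \sum_k floc A a p z.1 0 k * z.2 k j).
  by apply/funext => y; rewrite /frloc /= mulmxA mxE.
apply: (cvg_big add_continuous (nbhs_filter z)) => k _.
apply: cvgM.
  apply: (@cvg_comp _ _ _ fst (fun y => floc A a p y 0 k) _ (nbhs z.1)).
    exact: cvg_fst.
  exact: (smooth_on_continuous (sa p k)).
apply: (@cvg_comp _ _ _ snd (fun B : 'M[R]_n => B k j) _ (nbhs z.2)).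
  exact: cvg_snd.
exact: coord_continuous.
Qed.

(** By the cocycle identity the coordinates of a frame in the chart at [q], read
    in the bundle chart at [p], are obtained by a single transition from [p] to
    [q], whose entries vary continuously. *)
Lemma frloc_coord_continuous q i j p (z : 'cV[R]_n * 'M[R]_n) :
  cimg A p z.1 -> cdom A q (cinv A p z.1) ->
  {for z, continuous (frloc A (fun u => frame_coord A q u i j) p)}.
Proof.
move=> pz qz.
have near_eq : {near z, (fun y : 'cV[R]_n * 'M[R]_n =>
        \sum_k Jac A p q (cinv A p y.1) i k * y.2 k j)
    =1 frloc A (fun u => frame_coord A q u i j) p}.
  have near_base : nbhs z [set y | cimg A p y.1 /\ cdom A q (cinv A p y.1)].
    exact: (cvg_fst (near_cinv_in A (cdom_open A q) pz qz)).
  apply: (@filterS _ _ (nbhs_filter z) _ _ _ near_base) => y [py qy].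
  have [_ pcy] := cinvK A py.
  rewrite /frloc /frame_coord /= mulmxA Jac_comp ?mxE//.
  exact: cdom_self.
rewrite /prop_for /continuous_at.
have <- := nbhs_singleton near_eq.
apply: cvg_trans (near_eq_cvg near_eq) _.
apply: (cvg_big add_continuous (nbhs_filter z)) => k _.
apply: cvgM.
  apply: (@cvg_comp _ _ _ fst (fun y => Jac A p q (cinv A p y) i k) _ (nbhs z.1)).
    exact: cvg_fst.
  exact: Jac_continuous.
apply: (@cvg_comp _ _ _ snd (fun B : 'M[R]_n => B k j) _ (nbhs z.2)).
  exact: cvg_snd.
exact: coord_continuous.
Qed.

End FrameFunctions.

(** * Integrals, measurability and the start of stochastic integrals *)

Section NegligibleModification.
Context {d : measure_display} {Om : measurableType d} {R : realType}.
Variable mu : {measure set Om -> \bar R}.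

Import HBNNSimple.

(** The integral of an arbitrary nonnegative function is a supremum over the
    simple functions below it, and such a supremum ignores null sets as soon as
    one of the two functions is measurable: a simple function below [F] lies
    almost everywhere below [G], and a simple function below the restriction of
    [G] to the complement of [N] lies below [F]. *)
Lemma ge0_integral_modification (F G : Om -> \bar R) (N : set Om) :
  measurable N -> mu N = 0%E -> measurable_fun setT G ->
  (forall w, 0 <= F w)%E -> (forall w, 0 <= G w)%E ->
  (forall w, ~ N w -> F w = G w) ->
  (\int[mu]_w F w = \int[mu]_w G w)%E.
Proof.
move=> mN N0 mG F0 G0 FG; apply/eqP; rewrite eq_le; apply/andP; split.
  rewrite [leLHS]ge0_integralTE//; apply/ge_ereal_sup => _ /= [h hF <-].
  rewrite -integralT_nnsfun; apply: ae_ge0_le_integral => //.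
  - by move=> w _; rewrite lee_fin.
  - exact/measurable_EFinP.
  exists N; split=> // w; apply: contra_notP => Nw _.
  by rewrite -FG.
rewrite (ge0_negligible_integral mN)// integral_mkcond.
rewrite [leLHS]ge0_integralTE; last by move=> w; apply: erestrict_ge0.
rewrite [leRHS]ge0_integralTE//; apply: ereal_sup_le => _ /= [h hG <-].
exists h => // w; have := hG w; rewrite patchE; case: ifPn => [|_].
  by rewrite inE => -[_ Nw]; rewrite FG.
by move=> /le_trans; apply; exact: F0.
Qed.

Lemma integral_modification (f g : Om -> R) (N : set Om) :
  measurable N -> mu N = 0%E -> measurable_fun setT g ->
  (forall w, ~ N w -> f w = g w) ->
  (\int[mu]_w (f w)%:E = \int[mu]_w (g w)%:E)%E.
Proof.
move=> mN N0 /measurable_EFinP mg fg.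
rewrite integralE [RHS]integralE; congr (_ - _)%E.
- apply: ge0_integral_modification mN N0 _ _ _ _ => //.
  + exact: measurable_funepos.
  + by move=> w Nw; rewrite !funeposE fg.
- apply: ge0_integral_modification mN N0 _ _ _ _ => //.
  + exact: measurable_funeneg.
  + by move=> w Nw; rewrite !funenegE fg.
Qed.

End NegligibleModification.

Section Measurability.
Context {R : realType} {d : measure_display} {Om : measurableType d}.

Lemma measurable_fun_open_preimage (F : Om -> R) :
  (forall W, open W -> measurable (F @^-1` W)) -> measurable_fun setT F.
Proof.
move=> mF; apply: (measurability _ (RGenOpens.measurableE R)).
by move=> _ [_ [a [b ->]] <-]; rewrite setTI; exact/mF/interval_open.
Qed.

Lemma measurable_wrt_filtration (FF : @filtration R d Om) t (X : Om -> R) :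
  0 <= t -> measurable_wrt (FF t) X -> measurable_fun setT X.
Proof.
by move=> t0 mX _ C mC; rewrite setTI; exact/(filt_sub t0)/mX.
Qed.

Lemma measurable_mulmx_entry {m k l : nat} (B : Om -> 'M[R]_(m, k))
    (C : Om -> 'M[R]_(k, l)) :
  (forall i j, measurable_fun setT (fun w => B w i j)) ->
  (forall i j, measurable_fun setT (fun w => C w i j)) ->
  forall i j, measurable_fun setT (fun w => (B w *m C w) i j).
Proof.
move=> mB mC i j.
have -> : (fun w => (B w *m C w) i j) = (fun w => \sum_s B w i s * C w s j).
  by apply/funext => w; rewrite mxE.
by apply: measurable_sum => s; exact: measurable_funM.
Qed.

End Measurability.

Section ItoIntegral.
Context {R : realType} {d : measure_display} {Om : measurableType d}.
Context (P : probability Om R) (FF : @filtration R d Om).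

Lemma sp_integral0 (m k : nat) (H : simple_process FF m k)
    (X : R -> Om -> 'cV[R]_k) w : sp_integral H X 0 w = 0.
Proof.
rewrite /sp_integral big1// => l _.
by rewrite !min_l ?sp_time_ge0// subrr mulmx0.
Qed.

(** At time [0] every increment in the elementary integrals vanishes, and the
    integral is their uniform limit. *)
Lemma ito_integral0 (m k : nat) (T : R) (Phi : R -> Om -> 'M[R]_(m, k))
    (X : R -> Om -> 'cV[R]_k) (I : R -> Om -> 'cV[R]_m) :
  0 <= T -> ito_integral P FF T Phi X I -> {ae P, forall w, I 0 w = 0}.
Proof.
move=> T0 [_ [H aeH]]; apply: filterS aeH => w [_ _ unif].
apply/eqP; rewrite -normr_le0; apply/ler_addgt0Pr => e e0; rewrite add0r.
have [l _ /(_ l (leqnn l) 0)] := unif e e0.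
by rewrite sp_integral0 sub0r normrN; apply; rewrite lexx T0.
Qed.

End ItoIntegral.

(** * Measurability along frame processes and the balance of expectations *)

Section FrameMeasurability.
Context {R : realType} {n : nat} {M : topologicalType} {A : manifold R n M}.
Context (g : riemannian A) {d : measure_display} {Om : measurableType d}.

(** A process in the frame bundle is observed through frame-open sets, so a
    function that is continuous in the bundle charts over [D] is measurable
    along a process that stays over [D]. *)
Lemma measurable_frame_function (D : set M) (F : M * 'M[R]_n -> R)
    (X : Om -> M * 'M[R]_n) :
  open D -> (forall w, D (X w).1) ->
  (forall O, frame_open A O -> measurable (X @^-1` O)) ->
  (forall p (z : 'cV[R]_n * 'M[R]_n), cimg A p z.1 -> D (cinv A p z.1) ->
     {for z, continuous (frloc A F p)}) ->
  measurable_fun setT (F \o X).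
Proof.
move=> oD DX mX cF; apply: measurable_fun_open_preimage => W oW.
have -> : (F \o X) @^-1` W = X @^-1` [set u | D u.1 /\ W (F u)].
  by apply/seteqP; split=> w /=; [split|case].
exact/mX/frame_open_preimage.
Qed.

(** The inverse of an orthonormal frame is its metric adjoint, hence a linear
    function of the frame. *)
Lemma invmx_orthonormal_frame u : orthonormal_frame g u ->
  invmx u.2 = u.2^T *m metric g u.1.
Proof.
move=> u1; have [_ uu] := mulmx1_unit u1.
by rewrite -[RHS]mulmx1 -(mulmxV uu) mulmxA u1 mul1mx.
Qed.

Lemma flat_scale_inner (f : M -> R) V x (v : 'cV[R]_n) :
  (flat g (fun y => f y *: V y) x *m v) 0 0 = f x * inner g x (V x) v.
Proof. by rewrite /flat linearZ /= -!scalemxAl mxE. Qed.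

End FrameMeasurability.

Section Expectation.
Context {R : realType} {d : measure_display} {Om : measurableType d}.
Context (P : probability Om R).

(** Taking expectations in [m = a + b - q / 2] when [m] has mean [0].  The
    balance holds only almost surely and [b] is known to be bounded but not to
    be measurable: solving the balance for [b] yields a measurable version
    [b'], obtained by setting it to [0] on the exceptional set.  Similarly the
    integrability of [q] is read off from the balance. *)
Lemma expectation_of_balance (a b q m : Om -> R) (c : R) :
  P.-integrable setT (EFin \o a) -> P.-integrable setT (EFin \o m) ->
  (\int[P]_w (m w)%:E = 0)%E ->
  measurable_fun setT q -> (forall w, `|b w| <= c) ->
  {ae P, forall w, m w = a w + b w - 2^-1 * q w} ->
  ('E_P[a] = - 'E_P[b] + (2^-1)%:E * 'E_P[q])%E.
Proof.
move=> ia im m0 mq bc [N [mN N0 mE]].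
have {}mE w : ~ N w -> m w = a w + b w - 2^-1 * q w by apply: contra_notP => /mE.
have ma : measurable_fun setT a.
  by apply/measurable_EFinP; exact: measurable_int ia.
have mm : measurable_fun setT m.
  by apply/measurable_EFinP; exact: measurable_int im.
pose b' w := (m w - a w + 2^-1 * q w) * \1_(~` N) w.
have b'E w : ~ N w -> b w = b' w.
  move=> Nw; rewrite /b' indicE mem_set// mulr1 mE//.
  by rewrite addrAC subrK addrAC subrr add0r.
have mb' : measurable_fun setT b'.
  apply: measurable_funM; last exact/measurable_indic/measurableC.
  apply: measurable_funD; first exact: measurable_funB.
  exact: measurable_funM.
have ib' : P.-integrable setT (EFin \o b').
  apply: measurable_bounded_integrable => //.
    by rewrite (le_lt_trans (probability_le1 P measurableT))// ltry.
  exists c; split; first exact: num_real.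
  move=> x cx w _; apply: ltW; apply: le_lt_trans cx.
  have [Nw|/b'E <-//] := pselect (N w).
  rewrite /b' indicE memNset ?mulr0 ?normr0; last by move=> /(_ Nw).
  exact: le_trans (bc w).
pose q' w := 2 * (a w + b' w - m w).
have q'E w : ~ N w -> q w = q' w.
  move=> Nw; rewrite /q' -b'E// mE// opprB addrC subrK.
  by rewrite mulrA mulfV ?mul1r// pnatr_eq0.
have iab : P.-integrable setT (EFin \o (fun w => a w + b' w)).
  by have := integrableD measurableT ia ib'; congr (_.-integrable _ _).
have iabm : P.-integrable setT (EFin \o (fun w => a w + b' w - m w)).
  by have := integrableB measurableT iab im; congr (_.-integrable _ _).
rewrite unlock (integral_modification P b b' N)//.
rewrite (integral_modification P q q' N)//; last first.
  apply/measurable_funM => //; apply: measurable_funB => //.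
  exact: measurable_funD.
have -> : (\int[P]_w (q' w)%:E
    = 2%:E * (\int[P]_w (a w)%:E + \int[P]_w (b' w)%:E))%E.
  rewrite -(integralD measurableT ia ib') -[X in (_ * X)%E]sube0 -m0.
  rewrite -(integralB measurableT iab im) -(integralZl measurableT iabm).
  by [].
rewrite muleA -EFinM mulVf ?pnatr_eq0// mul1e.
rewrite addeCA [(- _ + _)%E]addeC subee ?adde0//.
exact: integrable_fin_num ib'.
Qed.

End Expectation.

(** * The integration by parts formula *)

Theorem corollary1p17
  (R : realType) (n : nat)
  (M : topologicalType) (A : manifold R n M) (g : riemannian A)
  (M_connected : connected [set: M])
  (M_complete : geodesically_complete g)
  (Z : M -> 'cV[R]_n) (Z_smooth : smooth_vector_field A Z)
  (d : measure_display) (Om : measurableType d) (P : probability Om R)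
  (FF : @filtration R d Om)
  (B : R -> Om -> 'cV[R]_n) (B_bm : brownian_motion2 P FF B)
  (x : M) (U : R -> Om -> M * 'M[R]_n)
  (U_sde : horizontal_diffusion g P FF Z x B U)
  (T : R) (T_gt0 : 0 < T)
  (h : R -> Om -> R)
  (h_adapted : adapted_on FF `[0, T] h)
  (h_paths : {ae P, forall w, [/\ cameron_martin T (h ^~ w), h 0 w = 0 & h T w = 1]})
  (f : M -> R) (f_smooth : smooth_function A f)
  (f_bounded : exists c : R, forall y, `|f y| <= c)
  (V : M -> 'cV[R]_n) (V_smooth : smooth_vector_field A V)
  (V_bounded : exists c : R, forall y, inner g y (V y) (V y) <= c)
  (divV_bounded : exists c : R, forall y, `|div g V y| <= c)
  (alpha : R -> M -> 'rV[R]_n)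
  (alpha_0 : alpha 0 = flat g (fun y => f y *: V y))
  (alpha_smooth : forall t, 0 <= t <= T -> smooth_form A (alpha t))
  (alpha_eq : forall t y, 0 <= t <= T ->
     has_derivative_on T (fun s => alpha s y) t (form_generator g Z (alpha t) y))
  (Theta : R -> Om -> 'M[R]_n)
  (Theta_adapted : adapted_mx_on FF `[0, T] Theta)
  (Theta_eq : {ae P, forall w, Theta 0 w = 1%:M /\
     forall t, 0 <= t <= T -> Theta t w \in unitmx /\
       has_derivative_on T (fun s => Theta s w) t
         (- (invmx (parallel_transport U t w)
             *m (ricci_sharp g (U t w).1
                 + adjoint g (U t w).1 (nabla g Z (U t w).1)
                 - (div g Z (U t w).1)%:M)
             *m parallel_transport U t w *m Theta t w))})
  (* \int_0^t (h'_s - (div Z)(X_s) h_s) Theta_s^-1 dB_s, B being regarded as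
     the T_xM-valued process U_0 B *)
  (I : R -> Om -> 'cV[R]_n)
  (I_ito : ito_integral P FF T
     (fun t w => (derive1 (h ^~ w) t - div g Z (U t w).1 * h t w)
                   *: invmx (Theta t w))
     (fun t w => (U 0 w).2 *m B t w) I)
  (true_martingale : martingale P FF T (fun t w =>
     div_form g (alpha (T - t)) (U t w).1 * h t w
     - 2^-1 * (alpha (T - t) (U t w).1
               *m (parallel_transport U t w *m Theta t w *m I t w)) 0 0))
  (* the expectation defining P_T (V(f)) (x) exists *)
  (Vf_integrable : P.-integrable setT (EFin \o (fun w => lie A V f (U T w).1))) :
  (semigroup P (fun t w => (U t w).1) T (lie A V f)
   = - 'E_P[fun w => (f (U T w).1 * div g V (U T w).1)%R]
     + (2^-1)%:E * 'E_P[fun w => (f (U T w).1 *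
         inner g (U T w).1 (V (U T w).1)
           (parallel_transport U T w *m Theta T w *m I T w))%R])%E.
Proof.
have T0 : 0 <= T := ltW T_gt0.
have [U0x U_orth U_meas _ _] := U_sde.
have [Madapted Mint Mmean] := true_martingale.
set m := (fun t w => _ - 2^-1 * _) in Madapted Mint Mmean.
have iM t : 0 <= t <= T -> P.-integrable setT (EFin \o m t) by exact: Mint.
(* The mean of the martingale is its mean at time 0, where h and the
   stochastic integral both vanish. *)
have mT0 : (\int[P]_w (m T w)%:E = 0)%E.
  rewrite (Mmean 0 T)//; last first.
    by have [F0 FC _] := filt_sigma FF (lexx 0); have := FC _ F0; rewrite setD0.
  have [N [mN N0 Nzero]] : {ae P, forall w, h 0 w = 0 /\ I 0 w = 0}.
    apply: filterS2 h_paths (ito_integral0 P FF _ _ _ _ _ _ T0 I_ito).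
    by move=> w [_ h0 _].
  rewrite (integral_modification P (m 0) (cst 0) N)//; first exact: integral0.
  move=> w Nw; have [h0 I0] : h 0 w = 0 /\ I 0 w = 0.
    by apply: contra_notP Nw => /Nzero.
  by rewrite /m h0 I0 !mulmx0 mxE !mulr0 subrr.
have frame_measurable t : 0 <= t ->
    forall O, frame_open A O -> measurable (U t @^-1` O).
  by move=> t0 O oO; apply: (filt_sub t0); exact: U_meas.
have smooth_alpha0 : smooth_form A (flat g (fun y => f y *: V y)).
  by rewrite -alpha_0; apply: alpha_smooth; rewrite lexx.
have inv_U0 w : invmx (U 0 w).2 = (U 0 w).2^T *m metric g x.
  by rewrite (invmx_orthonormal_frame g)// ?U0x//; exact: U_orth.
(* Every U_0 lies over x, where its own coordinates are those of the chart at
   x; the latter extend to the frames over a neighbourhood of x. *)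
have measurable_U0 i j : measurable_fun setT (fun w => (U 0 w).2 i j).
  have -> : (fun w => (U 0 w).2 i j) = (fun u => frame_coord A x u i j) \o U 0.
    apply/funext => w; rewrite /frame_coord /= U0x Jac_id ?mul1mx//.
    exact: cdom_self.
  apply: (measurable_frame_function (cdom A x)).
  - exact: cdom_open.
  - by move=> w; rewrite U0x; exact: cdom_self.
  - exact: (frame_measurable 0 (lexx 0)).
  - by move=> p z pz qz; exact: frloc_coord_continuous.
(* The pairing is the product of the components of alpha_0 in the frame U_T,
   of the inverse of U_0, of Theta_T and of I_T. *)
have measurable_pairing : measurable_fun setT (fun w => f (U T w).1 *
    inner g (U T w).1 (V (U T w).1)
      (parallel_transport U T w *m Theta T w *m I T w)).
  under eq_fun do rewrite -flat_scale_inner /parallel_transport inv_U0 !mulmxA.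
  have mI i j : measurable_fun setT (fun w => I T w i j).
    apply: (measurable_wrt_filtration FF T) => //; apply: I_ito.1.
    by rewrite /= in_itv /= T0 lexx.
  have mTheta i j : measurable_fun setT (fun w => Theta T w i j).
    apply: (measurable_wrt_filtration FF T) => //; apply: Theta_adapted.
    by rewrite /= in_itv /= T0 lexx.
  apply: measurable_mulmx_entry => // i j.
  apply: measurable_mulmx_entry => // {}i {}j.
  apply: measurable_mulmx_entry => // {}i {}j.
  apply: measurable_mulmx_entry => [{}i {}j|{}i {}j]; last first.
    by under eq_fun do rewrite mxE; exact: measurable_U0.
  rewrite ord1.
  apply: (measurable_frame_function (A := A) setT
    (fun u => (flat g (fun y => f y *: V y) u.1 *m u.2) 0 j) (U T)).
  - exact: openT.
  - by [].
  - exact: (frame_measurable T T0).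
  - by move=> p z pz _; exact: frloc_form_continuous.
have [cf f_le] := f_bounded; have [cV divV_le] := divV_bounded.
apply: (expectation_of_balance P _ _ _ (m T) (cf * cV)) => //.
- by apply: iM; rewrite T0 lexx.
- by move=> w; rewrite normrM ler_pM.
- apply: filterS h_paths => w [_ _ hT].
  rewrite /m hT mulr1 subrr alpha_0 flat_scale_inner; congr (_ - _).
  by rewrite /div_form flatK div_scale.
Qed.
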